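(* For every integer $n\ge3$ and every integer $r\ge1$, $$\Phi_{n,r}(1)=(-1)^r\,P_{-r-7}.$$
   Context: For integers $n\ge3$ and $r\ge1$, the digraph $\Gamma_{n,r}$ has vertex set $V(\Gamma_{n,r})=\{1,2,\dots,rn-2r+2\}$ and directed edge set $E(\Gamma_{n,r})$ defined by $E(\Gamma_{n,1})=\{(j,j+1):1\le j\le n-1\}\cup\{(n,1)\}$; $E(\Gamma_{n,2})=E(\Gamma_{n,1})\cup\{(1,n+1)\}\cup\{(j,j+1):n+1\le j\le 2n-3\}\cup\{(2n-2,n)\}$; and for $r\ge3$, $E(\Gamma_{n,r})=E(\Gamma_{n,2})\cup\bigcup_{i=1}^{r-2}F_i$, where $F_i=\{(in-2i+2,\,in+n-2i+1)\}\cup\{(j,j+1):in+n-2i+1\le j\le in+2n-2i-3\}\cup\{(in+2n-2i-2,\,in+n-2i)\}$. (For $n=3$ the middle path parts are empty.) The adjacency matrix $A_{n,r}$ is the $(0,1)$-matrix indexed by $V(\Gamma_{n,r})$ whose $(u,v)$-entry is $1$ if and only if $(u,v)\in E(\Gamma_{n,r})$, and $\Phi_{n,r}(x)=\det(xI-A_{n,r})\in\mathbb Z[x]$. The Padovan sequence (Padovan's spiral numbers) $\{P_m\}_{m\in\mathbb Z}$ is defined by $P_0=P_1=P_2=1$ and $P_{m+3}=P_{m+1}+P_m$ for all $m\in\mathbb Z$ (so it is extended to negative indices by the same recursion). *)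

(* Defs.v *)
From HB Require Import structures.
From mathcomp Require Import all_boot all_order all_algebra.

Set Implicit Arguments.
Unset Strict Implicit.
Unset Printing Implicit Defensive.

Import Order.TTheory GRing.Theory Num.Theory.

Local Open Scope nat_scope.

(* Vertices are labelled 1, 2, ..., r * n - 2 * r + 2 as natural numbers.  No  *)
(* subtraction below is truncated when n >= 3 (and i >= 1, r >= 1).            *)

Definition path_edge (a b u v : nat) : bool := (a <= u <= b) && (v == u.+1).

Definition edge1 (n u v : nat) : bool :=
  path_edge 1 (n - 1) u v || ((u, v) == (n, 1)).

Definition edge2 (n u v : nat) : bool :=
  [|| edge1 n u v,
      (u, v) == (1, n + 1),
      path_edge (n + 1) (2 * n - 3) u v
    | (u, v) == (2 * n - 2, n)].

Definition edgeF (n i u v : nat) : bool :=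
  [|| (u, v) == (i * n - 2 * i + 2, i * n + n - 2 * i + 1),
      path_edge (i * n + n - 2 * i + 1) (i * n + 2 * n - 2 * i - 3) u v
    | (u, v) == (i * n + 2 * n - 2 * i - 2, i * n + n - 2 * i)].

(* The value at r = 0 is irrelevant. *)
Definition Gamma_edge (n r u v : nat) : bool :=
  match r with
  | 0 | 1 => edge1 n u v
  | 2 => edge2 n u v
  | _ => edge2 n u v || has (fun i => edgeF n i u v) (iota 1 (r - 2))
  end.

Definition Gamma_order (n r : nat) : nat := r * n - 2 * r + 2.

Local Open Scope ring_scope.

(* The ordinal u : 'I_(Gamma_order n r) stands for the vertex labelled u + 1. *)
Definition Gamma_adj (n r : nat) : 'M[int]_(Gamma_order n r) :=
  \matrix_(u, v) (Gamma_edge n r u.+1 v.+1)%:R.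

Definition Phi (n r : nat) : {poly int} := char_poly (Gamma_adj n r).

(* padovan_triple m = (P_m, P_(m+1), P_(m+2)), obtained from (P_0, P_1, P_2)   *)
(* by running the recursion forwards or backwards.                             *)
Definition padovan_next (t : int * int * int) : int * int * int :=
  let: (a, b, c) := t in (b, c, b + a).

Definition padovan_prev (t : int * int * int) : int * int * int :=
  let: (a, b, c) := t in (c - a, a, b).

Definition padovan_triple (m : int) : int * int * int :=
  match m with
  | Posz k => iter k padovan_next (1, 1, 1)
  | Negz k => iter k.+1 padovan_prev (1, 1, 1)
  end.

Definition padovan (m : int) : int := (padovan_triple m).1.1.

Lemma padovan_init : [/\ padovan 0 = 1, padovan 1 = 1 & padovan 2 = 1].
Proof. by []. Qed.

Lemma padovan_tripleS (m : int) :
  padovan_triple (m + 1) = padovan_next (padovan_triple m).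
Proof.
have prevK : cancel padovan_prev padovan_next.
  by case=> [[a b] c]; rewrite /= addrC subrK.
case: m => [k|[|k]]; first by rewrite -PoszD addn1.
- by [].
- have -> : Negz k.+1 + 1 = Negz k by rewrite !NegzE -[in LHS]addn1 PoszD opprD subrK.
  by rewrite [padovan_triple (Negz k.+1)]/= -/(padovan_prev _) prevK.
Qed.

Lemma padovan_rec (m : int) : padovan (m + 3) = padovan (m + 1) + padovan m.
Proof.
have -> : m + 3 = m + 1 + 1 + 1 by rewrite -!addrA.
rewrite /padovan !padovan_tripleS.
by case: (padovan_triple m) => [[a b] c].
Qed.

(* Main.v *)
Require Import Defs.
From mathcomp Require Import all_boot all_order all_algebra.
From mathcomp Require Import zify ring.
Import GRing.Theory Num.Theory.
Local Open Scope ring_scope.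

(** [Phi n r] at 1 is [det (1 - A)], in which all arcs have weight 1, so that the
    lengths of the paths of the digraph do not matter: a path whose interior
    vertices have a single outgoing arc may be contracted to its end without
    changing the determinant ([det_contract]).

    Put [m = n - 2].  The vertices split into [r + 1] such blocks: the vertex
    labelled 1, the rest of the initial cycle, and the [r - 1] ears that are
    attached one after the other.  Only the end of a block has arcs that leave it.
    In the contracted digraph on [0 .. r], which no longer depends on [n], the end of
    block [k] leads back to block [k - 1] and forward to block [k + 2], with one
    additional arc [0 -> 1] inherited from the initial cycle ([det_Gamma_adj]).

    The matrix [1 - B] of the contracted digraph is Hessenberg with subdiagonal
    entries [-1].  Such a determinant is read off from a row vector [w] with first
    entry 1 that annihilates all columns but the last ([det_hessenberg]).  Here the
    condition on [w] is the recursion [w_(k+3) = w_(k+2) - w_k], which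
    [(-1)^(k+1) P_(-k-6)] satisfies, and the determinant is
    [w_(r+1) = (-1)^r P_(-r-7)] ([det_quotient_mx]). *)

(** * Determinants by contraction and by elimination *)

(** Sylvester's identity: both sides are the determinant of the block matrix
    [1 X; Y 1], eliminated from one corner or from the other. *)
Lemma det_sub1_mulmxC (R : comNzRingType) (p q : nat)
    (X : 'M[R]_(p, q)) (Y : 'M[R]_(q, p)) :
  \det (1%:M - X *m Y) = \det (1%:M - Y *m X).
Proof.
have EX : block_mx 1%:M X Y 1%:M =
    block_mx (1%:M - X *m Y) X 0 1%:M *m block_mx 1%:M 0 Y 1%:M.
  by rewrite mulmx_block ?(mulmx0, mul0mx, mulmx1, mul1mx, add0r, addr0) subrK.
have EY : block_mx 1%:M X Y 1%:M =
    block_mx 1%:M 0 Y (1%:M - Y *m X) *m block_mx 1%:M X 0 1%:M.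
  by rewrite mulmx_block ?(mulmx0, mul0mx, mulmx1, mul1mx, add0r, addr0) addrC subrK.
have := congr1 determinant EX; rewrite EY !det_mulmx.
by rewrite !det_ublock !det_lblock !det1 !mul1r !mulr1 => ->.
Qed.

(** Contraction of a digraph.  A vertex [u] other than the exit [e (b u)] of its
    block [b u] has exactly one outgoing arc, to the later vertex [nxt u] of the
    same block.  If [T] is the matrix of these arcs, [X] the incidence matrix of
    vertices and blocks, and [Y] consists of the rows of [A] at the exits, then
    [(1 - T) X] is the incidence matrix of the exits, because every indicator of
    a block telescopes along [nxt].  Hence [A = T + (1 - T) X Y], that is,
    [1 - A = (1 - T)(1 - X Y)]; the first factor is unitriangular, and Sylvester's
    identity turns the second one into [1 - Y X], whose entries count the arcs
    from an exit into a block. *)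
Lemma det_contract (R : comNzRingType) (p q : nat) (A : 'M[R]_p)
    (e : 'I_q -> 'I_p) (b : 'I_p -> 'I_q) (nxt : 'I_p -> 'I_p) :
    cancel e b ->
    (forall u, u != e (b u) -> [/\ (u < nxt u)%N, b (nxt u) = b u
       & forall v, A u v = (v == nxt u)%:R]) ->
  \det (1%:M - A) =
  \det (\matrix_(k, l) ((k == l)%:R - \sum_(v | b v == l) A (e k) v)).
Proof.
move=> eK interior.
pose T : 'M[R]_p := \matrix_(u, v) ((u != e (b u)) && (v == nxt u))%:R.
pose X : 'M[R]_(p, q) := \matrix_(u, k) (b u == k)%:R.
pose Y : 'M[R]_(q, p) := \matrix_(k, v) A (e k) v.
have TM (B : 'M[R]_(p, q)) u k :
    (T *m B) u k = (u != e (b u))%:R * B (nxt u) k.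
  rewrite mxE (bigD1 (nxt u)) //= big1 ?addr0 => [|v /negPf vNu].
    by rewrite mxE eqxx andbT.
  by rewrite mxE vNu andbF mul0r.
have endE : (1%:M - T) *m X = \matrix_(u, k) (u == e k)%:R.
  apply/matrixP => u k; rewrite mulmxBl mul1mx [LHS]mxE [X in _ + X]mxE TM !mxE.
  case: (altP (u =P e (b u))) => [uE|uNe]; last first.
    have [_ -> _] := interior _ uNe.
    rewrite mul1r subrr; case: eqP => // uE.
    by rewrite uE eK eqxx in uNe.
  by rewrite mul0r subr0 {2}uE (can_eq eK).
have dec : 1%:M - A = (1%:M - T) *m (1%:M - X *m Y).
  rewrite mulmxBr mulmx1 mulmxA endE -addrA -opprD; congr (_ - _).
  apply/matrixP => u v; rewrite !mxE.
  case: (altP (u =P e (b u))) => [uE|uNe] /=.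
    rewrite (bigD1 (b u)) //= big1 ?addr0 => [|k kNu].
      by rewrite !mxE -uE eqxx mul1r add0r.
    by rewrite mxE {1}uE (can_eq eK) eq_sym (negPf kNu) mul0r.
  have [_ _ ->] := interior _ uNe.
  rewrite big1 ?addr0 // => k _; rewrite !mxE.
  case: eqP => [uE|_]; last by rewrite mul0r.
  by rewrite uE eK eqxx in uNe.
have detT : \det (1%:M - T) = 1.
  rewrite -det_tr det_trig.
    rewrite big1 // => u _; rewrite !mxE eqxx.
    case: (altP (u =P e (b u))) => [|uNe] /=; first by rewrite subr0.
    have [lt_u _ _] := interior _ uNe.
    by rewrite -val_eqE /= (ltn_eqF lt_u) subr0.
  apply/is_trig_mxP => u v lt_uv; rewrite !mxE.
  rewrite -val_eqE /= (gtn_eqF lt_uv) sub0r.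
  case: (altP (v =P e (b v))) => [|vNe] /=; first by rewrite oppr0.
  have [lt_v _ _] := interior _ vNe.
  by rewrite -val_eqE /= (ltn_eqF (ltn_trans lt_uv lt_v)) oppr0.
rewrite dec det_mulmx detT mul1r det_sub1_mulmxC; congr (\det _).
apply/matrixP => k l; rewrite !mxE; congr (_ - _).
rewrite [RHS]big_mkcond; apply: eq_bigr => v _; rewrite !mxE.
by case: (b v == l); rewrite ?mulr1 ?mulr0.
Qed.

(** Left multiplication by the unimodular matrix that replaces the first row of
    [M] by [w *m M] leaves a first row that is zero except for [d] in the last
    column; the complementary minor is triangular with diagonal [-1], and the two
    signs [(-1) ^+ p] cancel. *)
Lemma det_hessenberg (R : comNzRingType) (p : nat) (M : 'M[R]_p.+1)
    (w : 'rV[R]_p.+1) (d : R) :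
    (forall i j : 'I_p.+1, (i = j.+1 :> nat) -> M i j = -1) ->
    (forall i j : 'I_p.+1, (j.+1 < i)%N -> M i j = 0) ->
    w 0 0 = 1 -> w *m M = d *: delta_mx 0 ord_max ->
  \det M = d.
Proof.
move=> Msub Mlow w0 wM.
pose W : 'M[R]_p.+1 := \matrix_(i, j) if i == 0 then w 0 j else (i == j)%:R.
have detW : \det W = 1.
  rewrite -det_tr det_trig.
    rewrite big1 // => i _; rewrite !mxE eqxx.
    by case: (altP (i =P 0)) => // ->.
  apply/is_trig_mxP => i j lt_ij; rewrite !mxE -!val_eqE /=.
  by rewrite (gtn_eqF (leq_ltn_trans _ lt_ij)) // (gtn_eqF lt_ij).
have W0 j : (W *m M) 0 j = d * (j == ord_max)%:R.
  have := congr1 (fun B : 'rV_p.+1 => B 0 j) wM.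
  rewrite [in RHS]mxE [in RHS]mxE eqxx /= => <-.
  by rewrite !mxE; apply: eq_bigr => k _; rewrite mxE.
have WS i j : (W *m M) (lift 0 i) j = M (lift 0 i) j.
  rewrite mxE (bigD1 (lift 0 i)) //= big1 ?addr0 => [|k /negPf kN].
    by rewrite mxE eqxx mul1r.
  by rewrite mxE (eq_sym _ k) kN mul0r.
have -> : \det M = \det (W *m M) by rewrite det_mulmx detW mul1r.
rewrite (expand_det_row _ 0) (bigD1 ord_max) //= big1 ?addr0; last first.
  by move=> j /negPf jN; rewrite W0 jN mulr0 mul0r.
rewrite W0 eqxx mulr1 /cofactor -det_tr.
set B := (row' _ _)^T.
have BE i j : B i j = M (lift 0 j) (lift ord_max i).
  by rewrite mxE [LHS]mxE [LHS]mxE WS.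
rewrite det_trig; last first.
  apply/is_trig_mxP => i j lt_ij; rewrite BE Mlow //=.
  by rewrite /bump (leqNgt p) ltn_ord.
rewrite (eq_bigr (fun=> -1)) => [|i _]; last first.
  by rewrite BE Msub //= /bump (leqNgt p) ltn_ord.
by rewrite prodr_const card_ord /= add0n -exprMn mulN1r opprK expr1n mulr1.
Qed.

Lemma sum_delta_ord (R : pzRingType) (p d : nat) (F : nat -> R) :
  \sum_(i < p) F i * (i == d :> nat)%:R = if (d < p)%N then F d else 0.
Proof.
case: ltnP => [d_p|p_d].
  rewrite (bigD1 (Ordinal d_p)) //= eqxx mulr1 big1 ?addr0 // => i iNd.
  by rewrite -val_eqE /= in iNd; rewrite (negPf iNd) mulr0.
by rewrite big1 // => i _; rewrite (ltn_eqF (leq_trans (ltn_ord i) p_d)) mulr0.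
Qed.

(** * The arcs of the digraph, block by block *)

(** The arcs in terms of [m = n - 2], with vertices numbered from 0.  The ear of
    index [k >= 2] occupies the vertices from [(k - 1) m + 2] to [k m + 1]; its arcs
    are one entering arc, the arcs along the ear and one leaving arc.  For
    [k = i + 2 >= 3] these are the arcs of [F_i]; the ear [k = 2] differs in that it
    is entered from vertex 0. *)
Lemma Gamma_edgeP (m r u v : nat) : (0 < m)%N -> (0 < r)%N ->
  reflect ([\/ (u <= m)%N /\ v = u.+1, u = m.+1 /\ v = 0%N,
               [/\ (1 < r)%N, u = 0%N & v = m.+2] |
            exists2 k, (1 < k <= r)%N &
              [\/ [/\ (2 < k)%N, u = ((k - 2) * m).+1 & v = (k.-1 * m).+2],
                  (k.-1 * m < u.-1)%N /\ (u <= k * m)%N /\ v = u.+1 |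
                  u = (k * m).+1 /\ v = (k.-1 * m).+1]])
    (Gamma_edge m.+2 r u.+1 v.+1).
Proof.
move=> m_gt0 r_gt0.
have -> : Gamma_edge m.+2 r u.+1 v.+1 =
    [|| edge1 m.+2 u.+1 v.+1, (1 < r)%N && edge2 m.+2 u.+1 v.+1 |
        has (fun i => edgeF m.+2 i u.+1 v.+1) (iota 1 (r - 2))].
  case: r r_gt0 => [|[|[|r]]] //= _.
  - by rewrite orbF.
  - by rewrite /edge2 orbF; case: (edge1 _ _ _).
  - by rewrite {2}/edge2 -/(edge2 _ _ _) /edge2; case: (edge1 _ _ _).
rewrite /edge1 /edge2 /edge1 /path_edge !xpair_eqE.
apply: (iffP idP).
  case/or3P.
  - move=> H; have [H1|H1] : (u <= m)%N /\ v = u.+1 \/ u = m.+1 /\ v = 0%N by lia.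
      by constructor 1.
    by constructor 2.
  - case/andP=> r_gt1 H.
    have [H1|[H1|[H1|[H1|H1]]]] : (u <= m)%N /\ v = u.+1 \/ u = m.+1 /\ v = 0%N
      \/ u = 0%N /\ v = m.+2 \/ (m < u.-1)%N /\ (u <= 2 * m)%N /\ v = u.+1 \/
      u = (2 * m).+1 /\ v = m.+1 by lia.
    + by constructor 1.
    + by constructor 2.
    + by constructor 3; case: H1.
    + by constructor 4; exists 2; rewrite ?r_gt1 //= mul1n; constructor 2.
    + by constructor 4; exists 2; rewrite ?r_gt1 //= mul1n; constructor 3.
  - case/hasP=> i; rewrite mem_iota => i_r.
    rewrite /edgeF /path_edge !xpair_eqE => H.
    constructor 4; exists i.+2; first by lia.
    rewrite !subSS subn0 /=.
    have [H1|[H1|H1]] : (u = (i * m).+1 /\ v = (i.+1 * m).+2) \/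
     ((i.+1 * m < u.-1)%N /\ (u <= i.+2 * m)%N /\ v = u.+1) \/
     (u = (i.+2 * m).+1 /\ v = (i.+1 * m).+1) by nia.
    + by constructor 1; case: H1 => *; split; lia.
    + by constructor 2.
    + by constructor 3.
case=> [H|H|[r_gt1 u0 vE]|[k k_r H]].
- by apply/or3P; constructor 1; lia.
- by apply/or3P; constructor 1; lia.
- by apply/or3P; constructor 2; lia.
have [k2|k2] := leqP k 2.
  have {}k2 : k = 2 by lia.
  subst k; apply/or3P; constructor 2; apply/andP; split; first by lia.
  by case: H => [[? ? ?]|[? [? ?]]|[? ?]]; lia.
apply/or3P; constructor 3; apply/hasP; exists (k - 2)%N.
  by rewrite mem_iota; lia.
rewrite /edgeF /path_edge !xpair_eqE.
case: k k_r k2 H => [|[|i]] // i_r i_gt0; rewrite !subSS subn0 /= => H.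
by case: H => [[? ? ?]|[? [? ?]]|[? ?]]; nia.
Qed.

(** Block 0 is the vertex 0, block 1 is the rest [1 .. m + 1] of the initial cycle,
    and block [k >= 2] is the ear of index [k], with vertices [(k - 1) m + 2 .. k m + 1].
    The truncated subtraction in [block] puts vertex 1, which makes block 1 one
    vertex longer than the others, into block 1. *)
Definition block_end (m k : nat) : nat := if k is 0 then 0 else (k * m).+1.
Definition block (m u : nat) : nat := if u is 0 then 0 else ((u - 2) %/ m).+1.

Lemma block_bounds m u : (0 < m)%N -> (0 < u)%N ->
  ((block m u).-1 * m <= u - 2 < block m u * m)%N.
Proof.
case: u => // u m_gt0 _; rewrite /block /= leq_divM /=.
by rewrite -ltn_divLR.
Qed.

Lemma block_eq m k u : (0 < m)%N -> (0 < u)%N -> (k * m <= u - 2 < k.+1 * m)%N ->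
  block m u = k.+1.
Proof.
move=> m_gt0 u_gt0 uk; case: u u_gt0 uk => // u _ uk; rewrite /block.
by congr _.+1; apply/eqP; rewrite eqn_leq -ltnS ltn_divLR // leq_divRL //; lia.
Qed.

Lemma block_endK m : (0 < m)%N -> cancel (block_end m) (block m).
Proof. by move=> m_gt0 [|k] //; apply: block_eq => //=; nia. Qed.

(** The three kinds of vertices: vertex 0, the ends of the later blocks (with one
    arc back to the end of the previous block and one forward to the start of the
    block two further on) and the interior vertices, whose only arc goes to the
    next vertex. *)
Lemma Gamma_edge_start (m r v : nat) : (0 < m)%N -> (0 < r)%N ->
  Gamma_edge m.+2 r 1 v.+1 = (v == 1%N) || (1 < r)%N && (v == m.+2).
Proof.
move=> m_gt0 r_gt0; apply/Gamma_edgeP/orP => //.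
  case=> [[_ ->]|[]|[-> _ ->]|[k k_r]] //; first by left.
    by right; rewrite eqxx.
  by case=> [[]|[]|[]]; rewrite ?ltn0.
case=> [/eqP->|/andP[r_gt1 /eqP->]]; first by constructor 1.
by constructor 3.
Qed.

Lemma Gamma_edge_end (m r k v : nat) : (0 < m)%N -> (k < r)%N ->
  Gamma_edge m.+2 r (block_end m k.+1).+1 v.+1 =
  (v == block_end m k) || (k.+2 < r)%N && (v == (k.+2 * m).+2).
Proof.
move=> m_gt0 k_r; rewrite /block_end; apply/Gamma_edgeP/orP => //; first by lia.
  case=> [[]|[]|[]|[j j_r]]; [nia| |lia|].
  - move=> kE ->; left; case: k {k_r} kE => //= k; nia.
  - case=> [[j_gt2 kE ->]|[jk [kj _]]|[kE ->]].
    + have jE : j = k.+3 by nia.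
      by right; rewrite jE eqxx andbT; lia.
    + have : (k.+1 < j)%N \/ (j <= k.+1)%N by lia.
      by case; nia.
    + have jE : j = k.+1 by nia.
      by left; rewrite jE in j_r *; case: (k) j_r => //= ?; rewrite eqxx.
case=> [/eqP->|/andP[kr /eqP->]]; last first.
  by constructor 4; exists k.+3; [lia | constructor 1; rewrite ?subSS ?subn0].
case: k k_r => [|k] k_r; first by constructor 2; rewrite mul1n.
by constructor 4; exists k.+2; [lia | constructor 3].
Qed.

Lemma Gamma_edge_interior (m r u v : nat) : (0 < m)%N -> (0 < r)%N ->
    (u < (r * m).+2)%N -> u != block_end m (block m u) ->
  Gamma_edge m.+2 r u.+1 v.+1 = (v == u.+1).
Proof.
move=> m_gt0 r_gt0; case: (posnP u) => [->|u_gt0] // u_r.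
have := block_bounds _ _ m_gt0 u_gt0.
have : (0 < block m u)%N by case: (u) u_gt0.
case: (block m u) => //= k _ uk une.
have k_r : (k < r)%N.
  by rewrite ltnNge; apply/negP => rk; have := leq_mul rk (leqnn m); nia.
apply/Gamma_edgeP/eqP => //.
  case=> [[_ ->]|[uE _]|[_ u0 _]|[j j_r]] //.
  - by case: k {k_r} uk une => [|k]; nia.
  - by lia.
  - case=> [[j_gt2 uE _]|[_ [_ ->]]|[uE _]] //.
    + have [|jk] := ltnP k (j - 2); first by nia.
      have := leq_mul jk (leqnn m); nia.
    + have [|jk] := ltnP k j; first by nia.
      have := leq_mul jk (leqnn m); nia.
move=> ->; case: k k_r uk une => [|k] k_r uk une.
  by constructor 1; lia.
by constructor 4; exists k.+2; [lia | constructor 2]; nia.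
Qed.

(** * The contracted digraph *)

(** The matrix [1 - B], where [B] is the adjacency matrix of the contracted
    digraph on [0 .. q - 1] with arcs [k + 1 -> k], [k -> k + 2] and the additional
    arc [0 -> 1]. *)
Definition quotient_mx (q : nat) : 'M[int]_q :=
  \matrix_(k, l) ((k == l :> nat)%:R - (k == l.+1 :> nat)%:R
    - (l == k.+2 :> nat)%:R - ((k == 0 :> nat) && (l == 1 :> nat))%:R).

Lemma Gamma_order_add2 m r : (0 < r)%N -> Gamma_order m.+2 r = (r * m).+2.
Proof. by rewrite /Gamma_order; nia. Qed.

Lemma det_Gamma_adj (m r : nat) : (0 < m)%N -> (0 < r)%N ->
  \det (1%:M - Gamma_adj m.+2 r) = \det (quotient_mx r.+1).
Proof.
move=> m_gt0 r_gt0; have NE := Gamma_order_add2 m r r_gt0.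
have e_lt (k : 'I_r.+1) : (block_end m k < Gamma_order m.+2 r)%N.
  by rewrite NE; case: k => [[|k] /= k_r] //; nia.
have b_lt (u : 'I_(Gamma_order m.+2 r)) : (block m u < r.+1)%N.
  have := ltn_ord u; move: (nat_of_ord u) => {}u; rewrite NE => u_r.
  case: u u_r => [|[|u]] u_r //; first by rewrite /block div0n.
  by rewrite /block ltnS ltn_divLR //; lia.
pose e k : 'I_(Gamma_order m.+2 r) := Ordinal (e_lt k).
pose b u : 'I_r.+1 := Ordinal (b_lt u).
pose nxt (u : 'I_(Gamma_order m.+2 r)) := insubd u u.+1.
rewrite (@det_contract _ _ _ _ e b nxt); first last.
- move=> u; rewrite -val_eqE /= => uNe.
  have u_lt : (u < (r * m).+2)%N by rewrite -NE.
  have bnd : (0 < u)%N.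
    by rewrite lt0n; apply: contraNneq uNe => ->.
  have [lo hi] := andP (block_bounds _ _ m_gt0 bnd).
  have b_r := b_lt u.
  have Sb : block m u = (block m u).-1.+1 by case: (nat_of_ord u) bnd.
  have Su_e : (u.+1 <= block_end m (block m u))%N.
    rewrite ltn_neqAle uNe Sb /block_end -Sb; lia.
  have Su_lt : (u.+1 < Gamma_order m.+2 r)%N.
    rewrite [X in (_ < X)%N]NE; apply: leq_ltn_trans Su_e _.
    by rewrite Sb /block_end -Sb ltnS ltnS leq_mul2r -ltnS b_r orbT.
  have nxtE : nxt u = u.+1 :> nat by rewrite val_insubd Su_lt.
  split=> [||v]; first by rewrite nxtE.
    apply: val_inj; rewrite /= nxtE Sb; apply: block_eq => //.
    rewrite Sb /block_end -Sb in Su_e; rewrite -Sb; lia.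
  by rewrite mxE (Gamma_edge_interior m r) // -val_eqE /= nxtE.
- by move=> k; apply: val_inj; rewrite /= block_endK.
congr (\det _); apply/matrixP => k l; rewrite !mxE.
rewrite -!addrA -!opprD; congr (_ - _).
have sumE (d : nat) c : (d < Gamma_order m.+2 r)%N || ~~ c ->
    \sum_(v < Gamma_order m.+2 r | b v == l) (c && (v == d :> nat))%:R =
    (c && (block m d == l))%:R :> int.
  case: c; last by rewrite big1.
  rewrite orbF => d_lt.
  transitivity (\sum_(v < Gamma_order m.+2 r)
      (block m v == l)%:R * (v == d :> nat)%:R : int).
    rewrite big_mkcond; apply: eq_bigr => v _.
    by rewrite -val_eqE /=; case: eqP; rewrite ?mul1r ?mul0r.
  by rewrite (sum_delta_ord _ _ _ (fun v => (block m v == l)%:R)) d_lt.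
have orbR (x y : bool) : ~~ (x && y) -> (x || y)%:R = x%:R + y%:R :> int.
  by case: x; case: y.
have l_r := ltn_ord l.
case: k => [[|k] k_r] /=.
  rewrite (eq_bigr (fun v : 'I_(Gamma_order m.+2 r) =>
     (true && (v == 1 :> nat))%:R + ((1 < r)%N && (v == m.+2 :> nat))%:R)).
    rewrite big_split /= (sumE _ true) ?sumE.
    + have -> : block m 1 = 1 by rewrite /block /= div0n.
      rewrite (block_eq m 1 m.+2) //; last by lia.
      by rewrite -!natrD; congr _%:R; lia.
    + by rewrite NE; nia.
    + by rewrite NE.
  move=> v _; rewrite mxE Gamma_edge_start // orbR //; lia.
rewrite (eq_bigr (fun v : 'I_(Gamma_order m.+2 r) =>
     (true && (v == block_end m k :> nat))%:R
     + ((k.+2 < r)%N && (v == (k.+2 * m).+2 :> nat))%:R)).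
  rewrite big_split /= (sumE _ true) ?sumE.
  + rewrite block_endK // (block_eq m k.+2 (k.+2 * m).+2) //; last by nia.
    by rewrite -!natrD; congr _%:R; lia.
  + by rewrite NE; nia.
  + by rewrite NE /block_end; case: (k) k_r => //= *; nia.
move=> v _; rewrite mxE Gamma_edge_end // orbR //.
by rewrite /block_end; case: (k) => *; nia.
Qed.

(** The vanishing of all columns but the last of [w *m quotient_mx] means
    [w_(k+1) = w_k - w_(k-2)], with the corrections [w_1 = w_0] and
    [w_2 = w_1 - w_0] caused by the missing index and by the arc [0 -> 1].  These
    are satisfied by Padovan numbers at negative indices with alternating signs:
    [w_(k+3) = w_(k+2) - w_k] is the Padovan recursion read backwards, and the
    shift by 6 comes from the initial values
    [P_(-6) = -1], [P_(-7) = 1], [P_(-8) = 0].  The remaining, last column is then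
    the next term [w_(q+1)]. *)
Lemma det_quotient_mx (q : nat) :
  \det (quotient_mx q.+1) = (-1) ^+ q * padovan (- q%:Z - 7).
Proof.
pose w (k : nat) : int := - (-1) ^+ k * padovan (- k%:Z - 6).
have w_rec k : w k.+3 = w k.+2 - w k.
  rewrite /w; have := padovan_rec (- k.+3%:Z - 6).
  have -> : - k.+3%:Z - 6 + 3 = - k%:Z - 6 by lia.
  have -> : - k.+3%:Z - 6 + 1 = - k.+2%:Z - 6 by lia.
  move=> ->; rewrite !exprS; ring.
have [w0 w1 w2] : [/\ w 0%N = 1, w 1%N = 1 & w 2 = 0] by [].
have -> : (-1) ^+ q * padovan (- q%:Z - 7) = w q.+1.
  rewrite /w exprS mulN1r opprK; congr (_ * padovan _); lia.
apply: (@det_hessenberg _ _ _ (\row_j w j)).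
- by move=> i j ij; rewrite mxE ij eqxx; do ![case: eqP => //=; try lia].
- by move=> i j ij; rewrite mxE; do ![case: eqP => //=; try lia].
- by rewrite mxE.
apply/rowP => l; rewrite !mxE eqxx /=.
transitivity (w l - (if (l.+1 < q.+1)%N then w l.+1 else 0)
  - (if (1 < l)%N then w (l - 2)%N else 0) - (l == 1 :> nat)%:R).
  have l_q := ltn_ord l.
  rewrite (eq_bigr (fun k : 'I_q.+1 => w k * (k == l :> nat)%:R
    - w k * (k == l.+1 :> nat)%:R
    - (1 < l)%N%:R * w k * (k == l - 2 :> nat)%N%:R
    - (l == 1 :> nat)%:R * w k * (k == 0 :> nat)%:R)) => [|k _]; last first.
    (* For l < 2 the truncated l - 2 is harmless: its term has the factor 1 < l. *)
    rewrite !mxE andbC -mulnb natrM.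
    have -> : (l == k.+2 :> nat) = (1 < l)%N && (k == l - 2 :> nat)%N.
      by apply/eqP/andP => [->|[? /eqP]]; [rewrite !subSS subn0 | lia].
    rewrite -mulnb natrM; ring.
  rewrite !sumrB !sum_delta_ord.
  rewrite (sum_delta_ord _ _ _ (fun k => (1 < l)%N%:R * w k)).
  rewrite (sum_delta_ord _ _ _ (fun k => (l == 1 :> nat)%:R * w k)) /=.
  rewrite l_q w0 mulr1 (leq_ltn_trans (leq_subr _ _) l_q).
  by case: (1 < l)%N; rewrite ?mul1r ?mul0r.
(* In the last column the term of the missing index l + 1 is absent, so that the
   recursion leaves w_(l+1) instead of 0. *)
rewrite -val_eqE /=; have [l_q|q_l] := ltnP l.+1 q.+1.
  rewrite (@ltn_eqF l q l_q) mulr0; case: (nat_of_ord l) => [|[|j]].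
  - by rewrite w0 w1.
  - by rewrite w1 w2.
  by rewrite w_rec !subSS subn0 /=; ring.
have -> : nat_of_ord l = q by have := ltn_ord l; lia.
rewrite eqxx mulr1 subr0; case: (q) => [|[|j]].
- by rewrite w0 w1.
- by rewrite w1 w2.
by rewrite w_rec !subSS subn0 /=; ring.
Qed.

Lemma Phi_at1 (n r : nat) : (Phi n r).[1] = \det (1%:M - Gamma_adj n r).
Proof.
rewrite /Phi /char_poly -horner_evalE -det_map_mx; congr (\det _).
apply/matrixP => u v.
by rewrite !mxE /= horner_evalE !(hornerE, hornerMn).
Qed.

Theorem lemma7p2 (n r : nat) (hn : (3 <= n)%N) (hr : (1 <= r)%N) :
  (Phi n r).[1] = (-1) ^+ r * padovan (- r%:Z - 7).
Proof.
case: n hn => [|[|m]] // m_gt0.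
by rewrite Phi_at1 det_Gamma_adj // det_quotient_mx.
Qed.
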